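(* Let $h\in(0,1]$, $k\in\mathbb{N}^*$, $K>0$, and let $P$ be a Borel probability measure on $\mathbb{R}^d$ with $\mathrm{Supp}(P)\subset\overline{B}(0,K)$, such that $P(\partial H(v,c_{P,h}(v)))=0$ for all $v\in\mathbb{R}^d$ with $\|v\|=1$. Then the set $\mathcal{O}pt(P,h,k)$ is not empty. Moreover, there is some $s=(s_1,\dots,s_k)\in\mathcal{O}pt(P,h,k)\cap\overline{B}(0,K)^{(k)}$ (together with measures $P_{s_i,h}\in\mathcal{P}_{s_i,h}(P)$ for which the minimum is attained and an associated set of weighted Voronoi measures $\tilde P_{s_1,h},\dots,\tilde P_{s_k,h}$) such that $s_i=\tilde m(\tilde P_{s_i,h})$ for all $i\in\{1,\dots,k\}$.
   Context: $\mathbb{R}^d$ carries the Euclidean norm; $B(x,r)$ and $\overline{B}(x,r)$ are the open and closed balls. For a unit vector $v$ and $c\in\mathbb{R}$, $H(v,c)=\{x:\langle x,v\rangle>c\}$. Conventions: $\inf\emptyset=+\infty$, $\sup\emptyset=-\infty$, $B(x,+\infty)=H(v,-\infty)=\mathbb{R}^d$ (with empty boundary). For a Borel probability measure $P$ with finite second moment: $\delta_{P,l}(x)=\inf\{r>0: P(\overline{B}(x,r))>l\}$; $c_{P,h}(v)=\sup\{c\in\mathbb{R}: P(H(v,c))>h\}$. Let $\overline{\mathbb{R}}_d=\mathbb{R}^d\cup\{v_\infty: \|v\|=1\}$, where $v_\infty$ is a point at infinity in direction $v$. For $x\in\mathbb{R}^d$, $\mathcal{P}_{x,h}(P)$ is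 the set of probability measures $P_{x,h}=\frac1h Q$ with $Q$ a sub-measure of $P$ of total mass $h$, coinciding with $P$ on $B(x,\delta_{P,h}(x))$ and supported on $\overline{B}(x,\delta_{P,h}(x))$. For $x=v_\infty$, $\mathcal{P}_{v_\infty,h}(P)$ is defined in the same way with $H(v,c_{P,h}(v))$ and its closure replacing the open and closed ball. $P_{x,h}$ denotes an element of $\mathcal{P}_{x,h}(P)$; $m(P_{x,h})=\int u\,dP_{x,h}(u)$ and $v(P_{x,h})=\int\|u-m(P_{x,h})\|^2dP_{x,h}(u)$. For a set $A$, $A^{(k)}$ is the set of $k$-tuples of elements of $A$ up to permutation. $\mathcal{O}pt(P,h,k)$ is the set of $t=(t_1,\dots,t_k)\in\overline{\mathbb{R}}_d^{(k)}$ minimizing $$\int\min_{i}\left(\|u-m(P_{t_i,h})\|^2+v(P_{t_i,h})\right)dP(u);$$ when the sets $\mathcal{P}_{t_i,h}(P)$ are not singletons, the minimization is over $t$ and over the choices of $P_{t_i,h}\in\mathcal{P}_{t_i,h}(P)$. A set of weighted Voronoi measures associated with $P$, $t\in\overline{\mathbb{R}}_d^{(k)}$, $h$ (and chosen $P_{t_i,h}$) is a family $\tilde P_{t_1,h},\dots,\tilde P_{t_k,h}$ of positive sub-measures of $P$ with $\sum_i\tilde P_{t_i,h}=P$ and such that for all $i$, all $x\in\mathrm{Supp}(\tilde P_{t_i,h})$ and all $j$, $\|x-m(P_{t_i,h})\|^2+v(P_{t_i,h})\le\|x-m(P_{t_j,h})\|^2+v(P_{t_j,h})$. Finally $\tilde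 m(\tilde P_{t_i,h})=\frac{1}{\tilde P_{t_i,h}(\mathbb{R}^d)}\int u\,d\tilde P_{t_i,h}(u)$, with the convention $\tilde m(\tilde P_{t_i,h})=0$ if $\tilde P_{t_i,h}(\mathbb{R}^d)=0$. *)

(* Defs.v *)
From HB Require Import structures.
From mathcomp Require Import all_boot all_order all_algebra perm.
From mathcomp Require Import all_classical all_reals all_analysis.
Set Implicit Arguments.
Unset Strict Implicit.
Unset Printing Implicit Defensive.
Import Order.TTheory GRing.Theory Num.Theory.
Import numFieldNormedType.Exports.
Local Open Scope classical_set_scope.
Local Open Scope ring_scope.

(* [borel R d] is the row-vector space 'rV[R]_d equipped with the sigma-algebra
   generated by the library's (product) topology, which is the Euclidean one. *)
Notation borel R d := (g_sigma_algebraType (@open 'rV[R]_d)).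

Section Euclidean.
Context {R : realType} {d : nat}.
Implicit Types (x y v : 'rV[R]_d) (r c : \bar R).

Definition dotv x y : R := \sum_(i < d) x 0 i * y 0 i.

(* The library's norm on matrices is the sup norm, hence this one. *)
Definition enorm x : R := Num.sqrt (dotv x x).

(* Radii and levels are extended reals: for r = +oo the balls are the whole
   space, and so is [halfspace v -oo]. *)
Definition oball x r : set 'rV[R]_d := [set y | ((enorm (y - x))%:E < r)%E].
Definition cball x r : set 'rV[R]_d := [set y | ((enorm (y - x))%:E <= r)%E].
Definition halfspace v c : set 'rV[R]_d := [set x | (c < (dotv x v)%:E)%E].

Definition boundary (A : set 'rV[R]_d) : set 'rV[R]_d := closure A `\` A°.

Definition sphere := {v : 'rV[R]_d | enorm v == 1}.

(* R^d together with one point at infinity per unit direction *)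
Inductive extspace : Type :=
| FinPt of 'rV[R]_d
| InfPt of sphere.

End Euclidean.

Arguments sphere : clear implicits.
Arguments extspace : clear implicits.

Section LocalMeasures.
Context {R : realType} {d : nat}.
Implicit Types (P : probability (borel R d) R) (h : R).
Implicit Types mu nu Q : {measure set (borel R d) -> \bar R}.

Definition msupport mu : set 'rV[R]_d :=
  [set x | forall U : set 'rV[R]_d, open U -> U x -> (0 < mu U)%E].

Definition submeasure nu mu : Prop :=
  forall A : set (borel R d), measurable A -> (nu A <= mu A)%E.

(* The conventions inf set0 = +oo and sup set0 = -oo are those of
   [ereal_inf] and [ereal_sup]. *)
Definition delta P (l : R) (x : 'rV[R]_d) : \bar R :=
  ereal_inf [set r%:E | r in [set r : R | 0 < r /\ (l%:E < P (cball x r%:E))%E]].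

Definition clevel P h (v : 'rV[R]_d) : \bar R :=
  ereal_sup [set c%:E | c in [set c : R | (h%:E < P (halfspace v c%:E))%E]].

(* [normalized_sub P h O C] is the set of measures Q / h, for Q a sub-measure of
   P of mass h that coincides with P on O and is supported on C. *)
Definition normalized_sub P h (O C : set 'rV[R]_d) :
    set (probability (borel R d) R) :=
  [set Ph | exists Q : {measure set (borel R d) -> \bar R},
    [/\ submeasure Q P,
        Q setT = h%:E,
        forall A : set (borel R d), measurable A -> A `<=` O -> Q A = P A,
        msupport Q `<=` C &
        forall A : set (borel R d), measurable A -> Ph A = (h^-1%:E * Q A)%E]].

Definition local_measures P h (x : extspace R d) :
    set (probability (borel R d) R) :=
  match x with
  | FinPt x => normalized_sub P h (oball x (delta P h x)) (cball x (delta P h x))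
  | InfPt v =>
      let H := halfspace (val v) (clevel P h (val v)) in
      normalized_sub P h H (closure H)
  end.

Definition vmean mu : 'rV[R]_d := \row_(i < d) \int[mu]_u (u 0 i).

Definition mvariance mu : R := \int[mu]_u (enorm (u - vmean mu) ^+ 2).

Definition power_dist mu (u : 'rV[R]_d) : R :=
  enorm (u - vmean mu) ^+ 2 + mvariance mu.

Section Tuples.
Context {k : nat}.
Implicit Types (t : 'I_k -> extspace R d) (M : 'I_k -> probability (borel R d) R).

Definition risk P M : \bar R :=
  (\int[P]_u \big[Order.min/+oo]_(i < k) (power_dist (M i) u)%:E)%E.

Definition admissible P h t M : Prop := forall i, local_measures P h (t i) (M i).

(* (t, M) attains the minimum over all pairs (points, choice of local measures) *)
Definition minimizes P h t M : Prop :=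
  admissible P h t M /\
  forall t' M', admissible P h t' M' -> (risk P M <= risk P M')%E.

(* Unordered k-tuples are represented by their orderings; [Opt_perm] below shows
   that Opt does not depend on the ordering. *)
Definition Opt P h : set ('I_k -> extspace R d) :=
  [set t | exists M, minimizes P h t M].

Definition weighted_voronoi P M
    (V : 'I_k -> {measure set (borel R d) -> \bar R}) : Prop :=
  [/\ forall i, submeasure (V i) P,
      forall A : set (borel R d), measurable A -> (\sum_(i < k) V i A)%E = P A &
      forall i x, msupport (V i) x ->
        forall j, power_dist (M i) x <= power_dist (M j) x].

End Tuples.

Definition wmean mu : 'rV[R]_d :=
  if mu setT == 0%E then 0 else (fine (mu setT))^-1 *: vmean mu.

Lemma Opt_perm k P h (t : 'I_k -> extspace R d) (s : 'S_k) :
  Opt P h t -> Opt P h (fun i => t (s i)).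
Proof.
move=> [M [aM minM]]; exists (fun i => M (s i)); split=> [i|t' M' /minM].
  exact: aM.
apply: le_trans; rewrite /risk le_eqVlt; apply/orP; left; apply/eqP.
apply: eq_integral => u _.
by rewrite [RHS](reindex_inj (h := s)) //=; exact: perm_inj.
Qed.

End LocalMeasures.

Arguments Opt {R d} k P h.

(* Main.v *)
(* For a probability M write m for its mean and a for its second moment; then
   power_dist M u = |u|^2 - 2 <u, m> + a = \int |u - z|^2 dM(z), which is affine
   in (m, a). Among the M with h M <= P, the value power_dist M x is least when M
   is a local measure P_{x,h}. The pairs (m, a) of all M with h M <= P form a
   bounded set, and the risk, as a function of k such pairs, attains its minimum
   at some theta in the k-th power of its closure. Let V_i be the Voronoi
   measures of theta, c_i their centroids and M_i = P_{c_i,h}. As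
   \int (|u|^2 - 2 <u, m> + a) dV_i = \int |u|^2 dV_i
     + V_i(R^d) (|c_i|^2 - 2 <c_i, m> + a - |c_i|^2),
   replacing theta_i by the moments of M_i does not increase the i-th term. So
   the M_i are optimal, and equality throughout shows that the V_i are Voronoi
   measures for the M_i as well. The passage from theta_i to c_i makes weak limits
   of the local measures, and thus points at infinity, unnecessary. *)

From HB Require Import structures.
Require Import Defs.
From mathcomp Require Import all_boot all_order all_algebra finmap.
From mathcomp Require Import all_classical all_reals all_analysis.
From mathcomp Require Import measurable_realfun.
From mathcomp Require Import ring lra.
Set Implicit Arguments.
Unset Strict Implicit.
Unset Printing Implicit Defensive.
Import Order.TTheory GRing.Theory Num.Theory.
Import numFieldNormedType.Exports.
Local Open Scope classical_set_scope.
Local Open Scope ring_scope.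

(** * Continuity of sums, differences, products and maxima of real functions *)

Section ContinuousArithmetic.
Context {R : realType} {T : topologicalType}.
Implicit Types f g : T -> R.

Lemma continuous_addf f g : continuous f -> continuous g ->
  continuous (fun x => f x + g x).
Proof. by move=> cf cg x; apply: cvgD; [exact: cf|exact: cg]. Qed.

Lemma continuous_subf f g : continuous f -> continuous g ->
  continuous (fun x => f x - g x).
Proof. by move=> cf cg x; apply: cvgB; [exact: cf|exact: cg]. Qed.

Lemma continuous_mulf f g : continuous f -> continuous g ->
  continuous (fun x => f x * g x).
Proof. by move=> cf cg x; apply: cvgM; [exact: cf|exact: cg]. Qed.

Lemma continuous_maxf f g : continuous f -> continuous g ->
  continuous (fun x => Num.max (f x) (g x)).
Proof. by move=> cf cg x; apply: continuous_max; [exact: cf|exact: cg]. Qed.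

End ContinuousArithmetic.

(** * Euclidean geometry *)

Section Geometry.
Context {R : realType} {d : nat}.
Implicit Types (x y u : 'rV[R]_d) (a r : R).

Lemma dotvDl x y u : dotv (x + y) u = dotv x u + dotv y u.
Proof. by rewrite -big_split; apply: eq_bigr => i _; rewrite mxE mulrDl. Qed.

Lemma dotvNl x u : dotv (- x) u = - dotv x u.
Proof. by rewrite -sumrN; apply: eq_bigr => i _; rewrite mxE mulNr. Qed.

Lemma dotvZl a x u : dotv (a *: x) u = a * dotv x u.
Proof. by rewrite /dotv mulr_sumr; apply: eq_bigr => i _; rewrite mxE mulrA. Qed.

Lemma dotvC x y : dotv x y = dotv y x.
Proof. by apply: eq_bigr => i _; rewrite mulrC. Qed.

Lemma dotv_sub_sqr x y :
  dotv (x - y) (x - y) = dotv x x - dotv x y *+ 2 + dotv y y.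
Proof.
rewrite dotvDl dotvNl !(dotvC _ (x - y)) !dotvDl !dotvNl (dotvC y x); ring.
Qed.

Lemma dotv_ge0 x : 0 <= dotv x x.
Proof. by apply: sumr_ge0 => i _; rewrite -expr2 sqr_ge0. Qed.

Lemma enorm_ge0 x : 0 <= enorm x.
Proof. exact: sqrtr_ge0. Qed.

Lemma enorm_sqr x : enorm x ^+ 2 = dotv x x.
Proof. by rewrite sqr_sqrtr ?dotv_ge0. Qed.

Lemma normr_coord_le_enorm x i : `|x 0 i| <= enorm x.
Proof.
rewrite -sqrtr_sqr ler_sqrt ?dotv_ge0// /dotv (bigD1 i)//= -expr2 lerDl.
by apply: sumr_ge0 => j _; rewrite -expr2 sqr_ge0.
Qed.

Lemma enorm_le r x : 0 <= r -> (enorm x <= r) = (dotv x x <= r ^+ 2).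
Proof. by move=> r0; rewrite -enorm_sqr ler_sqr ?nnegrE ?enorm_ge0. Qed.

Lemma dotv_continuous x : continuous (dotv x).
Proof.
apply: continuous_big => [|i _]; first exact: add_continuous.
by apply: continuous_mulf; [exact: cst_continuous|exact: coord_continuous].
Qed.

Lemma dotv_sqr_continuous : continuous (fun u : 'rV[R]_d => dotv u u).
Proof.
apply: continuous_big => [|i _]; first exact: add_continuous.
by apply: continuous_mulf; exact: coord_continuous.
Qed.

Lemma enorm_sub_continuous x : continuous (fun u : 'rV[R]_d => enorm (u - x)).
Proof.
move=> u; apply: (@continuous_comp _ _ _ (fun u => u - x) enorm).
  by apply: continuousB => //; exact: cst_continuous.
apply: (@continuous_comp _ _ _ (fun u => dotv u u) Num.sqrt).
  exact: dotv_sqr_continuous.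
exact: sqrt_continuous.
Qed.

Lemma oball_open x r : open (oball x r%:E).
Proof.
rewrite (_ : oball x r%:E = (fun u => enorm (u - x)) @^-1` [set y | y < r]).
  by apply: open_comp; [move=> u _; exact: enorm_sub_continuous|exact: open_lt].
by apply/seteqP; split => u; rewrite /oball /= lte_fin.
Qed.

Lemma cball_closed x r : closed (cball x r%:E).
Proof.
rewrite (_ : cball x r%:E = (fun u => enorm (u - x)) @^-1` [set y | y <= r]).
  apply: closed_comp; last exact: closed_le.
  by move=> u _; exact: enorm_sub_continuous.
by apply/seteqP; split => u; rewrite /cball /= lee_fin.
Qed.

(** Coordinates are bounded by the Euclidean norm, so the ball is a closed subset of a product of
    segments. *)
Lemma cball_compact x r : compact (cball x r%:E).
Proof.
apply: (subclosed_compact (@cball_closed x r)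
  (rV_compact (fun i => @segment_compact R (x 0 i - r) (x 0 i + r)))).
move=> u; rewrite /cball /= lee_fin => ur i; rewrite /= in_itv /=.
have := le_trans (normr_coord_le_enorm (u - x) i) ur.
by rewrite !mxE ler_distl.
Qed.

Lemma open_measurable_borel (A : set 'rV[R]_d) :
  open A -> measurable (A : set (borel R d)).
Proof. exact: sub_sigma_algebra. Qed.

Lemma closed_measurable_borel (A : set 'rV[R]_d) :
  closed A -> measurable (A : set (borel R d)).
Proof.
move=> cA; rewrite -[A]setCK; apply: measurableC.
by apply: open_measurable_borel; exact: closed_openC.
Qed.

Lemma continuous_measurable_borel (f : 'rV[R]_d -> R) :
  continuous f -> measurable_fun setT (f : borel R d -> R).
Proof.
move=> cf; apply: (measurability _ (RGenOpens.measurableE R)).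
move=> _ [_ [x [y ->]] <-]; rewrite setTI; apply: open_measurable_borel.
by apply: open_comp; [move=> u _; exact: cf|exact: interval_open].
Qed.
End Geometry.

(** * Integrals of continuous functions against compactly carried measures *)

Section CarriedMeasures.
Context {R : realType} {d : nat}.
Implicit Types (x y u m : 'rV[R]_d) (a r K : R) (f g : 'rV[R]_d -> R).
Implicit Types mu nu : {measure set (borel R d) -> \bar R}.

(** Stands in for the inclusion of the support in the ball: a null complement passes directly to
    sub-measures, and together with finite mass it makes every continuous function integrable. *)
Definition carried K mu : Prop :=
  (mu setT < +oo)%E /\ mu (~` cball 0 K%:E) = 0%E.

Lemma measurable_cball x r : measurable (cball x r%:E : set (borel R d)).
Proof. by apply: closed_measurable_borel; exact: cball_closed. Qed.

Lemma measurable_oball x r : measurable (oball x r%:E : set (borel R d)).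
Proof. by apply: open_measurable_borel; exact: oball_open. Qed.

Lemma carried_sub K mu nu : submeasure nu mu -> carried K mu -> carried K nu.
Proof.
move=> numu [muoo mu0]; split; first exact: le_lt_trans (numu _ measurableT) _.
apply/eqP; rewrite eq_le measure_ge0 andbT -mu0; apply: numu.
by apply: measurableC; exact: measurable_cball.
Qed.

(** The complement of the ball is negligible, and on the compact ball f is bounded while the mass is
    finite. *)
Lemma carried_integrable K mu f : carried K mu -> continuous f ->
  mu.-integrable setT (EFin \o f : borel R d -> \bar R).
Proof.
move=> [muoo mu0] cf; have mf := continuous_measurable_borel cf.
apply/(negligible_integrable (measurableC (measurable_cball 0 K))) => //.
  exact/measurable_EFinP.
rewrite setTD setCK; apply: measurable_bounded_integrable.
- exact: measurable_cball.
- apply: le_lt_trans muoo; apply: le_measure; rewrite ?inE//.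
  exact: measurable_cball.
- exact: measurable_funTS.
have : bounded_set (f @` cball 0 K%:E).
  apply/compact_bounded/continuous_compact; last exact: cball_compact.
  exact: continuous_subspaceT.
move=> [M [Mr MB]]; exists M; split => // x Mx u Ku.
by apply: MB => //; exists u.
Qed.

(** Both integrals see only the intersection of [C] with the ball, whose complement is null, so the
    pointwise inequality is required there alone. *)
Lemma Rintegral_le_on K mu f g (C : set (borel R d)) : carried K mu ->
  continuous f -> continuous g -> measurable C -> mu (~` C) = 0%E ->
  (forall u, C u -> cball 0 K%:E u -> f u <= g u) ->
  \int[mu]_u f u <= \int[mu]_u g u.
Proof.
move=> cmu cf cg mC muC fg.
have [muoo mu0] := cmu.
have mKC := measurableI _ _ mC (measurable_cball 0 K).
have muKC : mu (~` (C `&` cball 0 K%:E)) = 0%E.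
  rewrite setCI measureU0//; first exact: measurableC.
  by apply: measurableC; exact: measurable_cball.
have restr (e : 'rV[R]_d -> R) : continuous e ->
    \int[mu]_u e u = \int[mu]_(u in C `&` cball 0 K%:E) e u.
  move=> ce; rewrite /Rintegral (negligible_integral (measurableC mKC))//.
    by rewrite setTD setCK.
  exact: carried_integrable cmu ce.
rewrite !restr//; apply: le_Rintegral => //.
- apply: integrableS (carried_integrable cmu cf) => //.
- apply: integrableS (carried_integrable cmu cg) => //.
- by move=> u [? ?]; exact: fg.
Qed.

Lemma Rintegral_le K mu f g : carried K mu -> continuous f -> continuous g ->
  (forall u, f u <= g u) -> \int[mu]_u f u <= \int[mu]_u g u.
Proof.
by move=> cmu cf cg fg; apply: (Rintegral_le_on cmu cf cg measurableT);
  rewrite ?setCT ?measure0.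
Qed.

Lemma RintegralD_carried K mu f g : carried K mu -> continuous f ->
  continuous g ->
  \int[mu]_u (f u + g u) = \int[mu]_u f u + \int[mu]_u g u.
Proof.
by move=> cmu cf cg; apply: RintegralD => //; exact: (@carried_integrable K).
Qed.

Lemma RintegralZ_carried K mu f a : carried K mu -> continuous f ->
  \int[mu]_u (a * f u) = a * \int[mu]_u f u.
Proof.
by move=> cmu cf; apply: RintegralZl => //; exact: (@carried_integrable K).
Qed.

Lemma Rintegral_cst_setT mu a : \int[mu]_u a = a * fine (mu setT).
Proof. by rewrite Rintegral_cst. Qed.

Lemma Rintegral_dotv K mu x : carried K mu ->
  \int[mu]_u dotv u x = dotv (vmean mu) x.
Proof.
move=> cmu; have cfd i : continuous (fun u : 'rV[R]_d => u 0 i * x 0 i).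
  by apply: continuous_mulf; [exact: coord_continuous|exact: cst_continuous].
rewrite /dotv; under [RHS]eq_bigr do rewrite mxE.
have -> : \sum_(i < d) (\int[mu]_u u 0 i) * x 0 i =
    \sum_(i < d) (\int[mu]_u (u 0 i * x 0 i)).
  apply: eq_bigr => i _; rewrite mulrC -(RintegralZ_carried _ cmu).
    by apply: eq_Rintegral => u _; rewrite mulrC.
  exact: coord_continuous.
elim: (index_enum _) => [|i s IH].
  under eq_Rintegral do rewrite big_nil.
  by rewrite big_nil Rintegral_cst_setT mul0r.
under eq_Rintegral do rewrite big_cons.
rewrite big_cons -IH (RintegralD_carried cmu)//.
by apply: continuous_big => // ; exact: add_continuous.
Qed.

End CarriedMeasures.

(** * First and second moments, and the paraboloids they determine *)

Section Moments.
Context {R : realType} {d : nat}.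
Implicit Types (x y u m c : 'rV[R]_d) (a r K : R).
Implicit Types mu nu : {measure set (borel R d) -> \bar R}.

Definition second_moment mu : R := \int[mu]_u dotv u u.

(** The parameters are free rather than tied to a measure, so that limits of moments can be
    substituted as well; the value is affine in (m, a). *)
Definition paraboloid m a u : R := dotv u u + (- 2 * dotv u m + a).

Lemma dotv_continuousl x : continuous (fun u : 'rV[R]_d => dotv u x).
Proof. by under eq_fun do rewrite dotvC; exact: dotv_continuous. Qed.

Lemma affine_continuous m a :
  continuous (fun u : 'rV[R]_d => - 2 * dotv u m + a).
Proof.
apply: continuous_addf; last exact: cst_continuous.
by apply: continuous_mulf; [exact: cst_continuous|exact: dotv_continuousl].
Qed.

Lemma paraboloid_continuous m a : continuous (paraboloid m a).
Proof.
by apply: continuous_addf; [exact: dotv_sqr_continuous|exact: affine_continuous].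
Qed.

Lemma sqdist_paraboloid x u : dotv (u - x) (u - x) = paraboloid x (dotv x x) u.
Proof. rewrite dotv_sub_sqr /paraboloid; ring. Qed.

Lemma Rintegral_paraboloid K mu m a : carried K mu ->
  \int[mu]_u paraboloid m a u =
  second_moment mu - 2 * dotv (vmean mu) m + a * fine (mu setT).
Proof.
move=> cmu; rewrite (RintegralD_carried cmu); last 2 first.
- exact: dotv_sqr_continuous.
- exact: affine_continuous.
rewrite (RintegralD_carried cmu); last 2 first.
- by apply: continuous_mulf; [exact: cst_continuous|exact: dotv_continuousl].
- exact: cst_continuous.
rewrite Rintegral_cst_setT (RintegralZ_carried _ cmu); last first.
  exact: dotv_continuousl.
rewrite (Rintegral_dotv _ cmu) /second_moment; ring.
Qed.

Lemma Rintegral_paraboloid_prob K (M : probability (borel R d) R) m a :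
  carried K M ->
  \int[M]_u paraboloid m a u = second_moment M - 2 * dotv (vmean M) m + a.
Proof.
move=> cM; rewrite (Rintegral_paraboloid _ _ cM); congr (_ + _).
rewrite -[RHS]mulr1; congr (_ * _).
by have /= -> := probability_setT M.
Qed.

(** The variance is the second moment minus |m|^2, and this |m|^2 cancels the one in |u - m|^2. *)
Lemma power_distE K (M : probability (borel R d) R) : carried K M ->
  power_dist M = paraboloid (vmean M) (second_moment M).
Proof.
move=> cM; apply/funext => u; rewrite /power_dist /mvariance enorm_sqr.
under eq_Rintegral do rewrite enorm_sqr sqdist_paraboloid.
rewrite (Rintegral_paraboloid_prob _ _ cM) sqdist_paraboloid.
rewrite /paraboloid; ring.
Qed.

(** The bias-variance identity. It makes minimizing [power_dist] at x a matter of placing mass close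
    to x. *)
Lemma power_dist_Rintegral K (M : probability (borel R d) R) x : carried K M ->
  power_dist M x = \int[M]_u dotv (u - x) (u - x).
Proof.
move=> cM; rewrite (power_distE cM).
under eq_Rintegral do rewrite sqdist_paraboloid.
rewrite (Rintegral_paraboloid_prob _ _ cM) /paraboloid dotvC; ring.
Qed.

(** [vmean] does not divide by the mass, so for a general measure it is the first moment. The null
    measure is no exception, since its first moment is 0. *)
Lemma vmean_wmean K mu : carried K mu ->
  vmean mu = fine (mu setT) *: wmean mu.
Proof.
move=> cmu; rewrite /wmean; have [mu0|mu0] := eqVneq (mu setT) 0%E.
  rewrite mu0 scale0r; apply/rowP => i; rewrite !mxE /Rintegral.
  have mi := continuous_measurable_borel (@coord_continuous _ 1 d 0 i).
  by rewrite null_set_integral//; exact/measurable_EFinP.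
rewrite scalerA divff ?scale1r// fine_eq0//.
by rewrite ge0_fin_numE//; case: cmu.
Qed.

(** The parameters enter only through the value at the centroid, so comparing the integrals of two
    paraboloids reduces to comparing them at one point. *)
Lemma Rintegral_paraboloid_wmean K mu m a : carried K mu ->
  \int[mu]_u paraboloid m a u = second_moment mu +
  fine (mu setT) * (paraboloid m a (wmean mu) - dotv (wmean mu) (wmean mu)).
Proof.
move=> cmu; rewrite (Rintegral_paraboloid _ _ cmu) (vmean_wmean cmu) dotvZl.
rewrite /paraboloid; ring.
Qed.

Lemma second_moment_le K mu : 0 <= K -> carried K mu ->
  second_moment mu <= K ^+ 2 * fine (mu setT).
Proof.
move=> K0 cmu; rewrite -Rintegral_cst_setT.
apply: (Rintegral_le_on cmu _ _ (measurable_cball 0 K)).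
- exact: dotv_sqr_continuous.
- exact: cst_continuous.
- by case: cmu.
- by move=> u _; rewrite /cball/= lee_fin subr0 enorm_le.
Qed.

Lemma second_moment_ge0 mu : 0 <= second_moment mu.
Proof. by apply: Rintegral_ge0 => u _; exact: dotv_ge0. Qed.

Lemma wmean_cball K mu : 0 <= K -> carried K mu -> cball 0 K%:E (wmean mu).
Proof.
move=> K0 cmu; rewrite /cball/= lee_fin subr0 enorm_le//.
have [mu0|mu0] := eqVneq (mu setT) 0%E.
  by rewrite /wmean mu0 eqxx -[X in dotv X X](scale0r 0) dotvZl mul0r sqr_ge0.
have muf : mu setT \is a fin_num by rewrite ge0_fin_numE//; case: cmu.
have p0 : 0 < fine (mu setT).
  by rewrite lt_neqAle eq_sym fine_eq0// mu0 fine_ge0.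
(* This integral is the second moment minus the mass times |[wmean mu]|^2. As the second moment is
   at most K^2 times the mass, dividing by the positive mass gives the bound. *)
have : 0 <= \int[mu]_u dotv (u - wmean mu) (u - wmean mu).
  by apply: Rintegral_ge0 => u _; exact: dotv_ge0.
under eq_Rintegral do rewrite sqdist_paraboloid.
rewrite (Rintegral_paraboloid_wmean _ _ cmu) => /le_trans.
move=> /(_ _ (lerD (second_moment_le K0 cmu) (lexx _))).
rewrite /paraboloid mulrC -mulrDr pmulr_rge0//; lra.
Qed.

End Moments.

(** * The complement of the support is negligible *)

Section SupportNull.
Context {R : realType} {d : nat}.
Implicit Types (mu : {measure set (borel R d) -> \bar R}) (K : R).

(** Each point of A has a null open neighborhood, and finitely many of these cover A. *)
Lemma compact_negligible mu (A : set 'rV[R]_d) :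
  compact A -> (forall x, A x -> ~ msupport mu x) -> mu.-negligible A.
Proof.
move=> cA Anull.
have cover x : exists U : set 'rV[R]_d,
    open U /\ (A x -> U x /\ mu.-negligible U).
  have [Ax|nAx] := pselect (A x); last by exists setT; split => //; exact: openT.
  have := Anull x Ax; rewrite /msupport /= => /existsNP[U /not_implyP[oU]].
  move=> /not_implyP[Ux /negP]; rewrite -leNgt measure_le0 => /eqP U0.
  exists U; split => // _; split => //; apply/negligibleP => //.
  exact: open_measurable_borel.
pose U x := projT1 (cid (cover x)).
have oU x : open (U x) by rewrite /U; case: cid => V [].
have AU x : A x -> U x x /\ mu.-negligible (U x).
  by rewrite /U; case: cid => V [].
have := cA; rewrite compact_cover => /(_ _ A U (fun i _ => oU i)).
case=> [x Ax|D DA AD]; first by exists x => //; case: (AU x Ax).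
apply: (@negligibleS _ _ _ mu (\bigcup_(i in [set` D]) U i) A) => //.
rewrite bigcup_fset big_seq_cond.
apply: (big_ind (fun B : set (borel R d) => mu.-negligible B)).
- exact: negligible_set0.
- by move=> B C; exact: negligibleU.
- move=> x; rewrite andbT => /DA /set_mem Ax.
  by case: (AU x Ax).
Qed.

Lemma carried_msupport (P : probability (borel R d) R) K :
  msupport P `<=` cball 0 K%:E -> carried K P.
Proof.
move=> suppP; split; first by rewrite (le_lt_trans (probability_le1 _ _)) ?ltry.
apply/negligibleP; first by apply: measurableC; exact: measurable_cball.
(* These shells are closed and bounded, hence compact; they miss the support and together exhaust
   the complement of the ball. *)
pose G n : set 'rV[R]_d :=
  [set u | K + n.+1%:R^-1 <= enorm (u - 0)] `&` cball 0 n%:R%:E.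
apply: (@negligibleS _ (borel R d) R P (\bigcup_n G n)); last first.
  apply: negligible_bigcup => n; apply: compact_negligible.
    apply: (subclosed_compact _ (@cball_compact _ _ 0 n%:R));
      last by move=> x [].
    apply: closedI; last exact: cball_closed.
    rewrite (_ : mkset _ =
      (fun u => enorm (u - 0)) @^-1` [set y | K + n.+1%:R^-1 <= y])//.
    apply: preimage_closed; last exact: closed_ge.
    by move=> u _; exact: enorm_sub_continuous.
  move=> x [/= Kx _] /suppP; rewrite /cball /= lee_fin leNgt => /negP; apply.
  by apply: lt_le_trans Kx; rewrite ltrDl invr_gt0.
move=> u /= /negP; rewrite lee_fin -ltNge => Ku.
have e0 : 0 < enorm (u - 0) - K by rewrite subr_gt0.
near \oo => n; exists n => //; split => /=.
  rewrite -lerBrDl; apply: ltW.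
  by near: n; exact: (near_infty_natSinv_lt (PosNum e0)).
by rewrite /cball/= lee_fin; near: n; exact: nbhs_infty_ger.
Unshelve. all: by end_near. Qed.

End SupportNull.

(** * Comparison of measures by their concentration around a point *)

Section Optimality.
Context {R : realType} {d : nat}.
Implicit Types mu nu : {measure set (borel R d) -> \bar R}.

(** Since f vanishes off [C], both integrals may be taken against the restrictions to [C], and these
    are ordered on all measurable sets. *)
Lemma Rintegral_sub_on K mu nu (f : 'rV[R]_d -> R) (C : set (borel R d)) :
  carried K mu -> carried K nu -> measurable C ->
  (forall A : set (borel R d), measurable A -> A `<=` C -> (nu A <= mu A)%E) ->
  continuous f -> (forall u, 0 <= f u) -> (forall u, ~ C u -> f u = 0) ->
  \int[nu]_u f u <= \int[mu]_u f u.
Proof.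
move=> cmu cnu mC numu cf f0 fC.
have E (la : {measure set (borel R d) -> \bar R}) :
    (\int[la]_u (f u)%:E = \int[mrestr la mC]_u (f u)%:E)%E.
  have fE : (fun u : borel R d => (f u)%:E) = (EFin \o f) \_ C.
    apply/funext => u; rewrite patchE; case: ifPn => //.
    by rewrite notin_setE => /fC ->.
  rewrite fE -[LHS]integral_mkcond -[RHS]integral_mkcond.
  by apply: eq_measure_integral => A mA AC /=; rewrite /mrestr setIidl.
rewrite /Rintegral; apply: fine_le.
- exact/integrable_fin_num/(carried_integrable cnu cf).
- exact/integrable_fin_num/(carried_integrable cmu cf).
- rewrite (E nu) (E mu); apply: ge0_le_measure_integral => //.
  + move=> A mA /=; rewrite /mrestr; apply: numu; last exact: subIsetr.
    exact: measurableI.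
  + by apply/measurable_EFinP; exact: continuous_measurable_borel.
Qed.

(** Bathtub principle: at equal total mass, [mu] dominates [nu] inside the open ball and has nothing
    beyond the closed ball, so its mass lies at least as close to x. *)
Lemma concentrated_le K mu nu x r : carried K mu -> carried K nu -> 0 <= r ->
  mu setT = nu setT -> mu (~` cball x r%:E) = 0%E ->
  (forall A : set (borel R d), measurable A -> A `<=` oball x r%:E ->
    (nu A <= mu A)%E) ->
  \int[mu]_u dotv (u - x) (u - x) <= \int[nu]_u dotv (u - x) (u - x).
Proof.
move=> cmu cnu r0 munuT muC numu.
pose q (u : 'rV[R]_d) : R := dotv (u - x) (u - x).
have cq : continuous q.
  rewrite (_ : q = paraboloid x (dotv x x)); first exact: paraboloid_continuous.
  by apply/funext => u; exact: sqdist_paraboloid.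
(* The excess of the squared distance over r^2 splits into p, which vanishes
   mu-almost everywhere, and n, which lives on the open ball. *)
pose e u := q u - r ^+ 2.
have ce : continuous e by apply: continuous_subf => //; exact: cst_continuous.
pose p u := Num.max (e u) 0.
pose n u := Num.max (- 1 * e u) 0.
have cp : continuous p by apply: continuous_maxf => //; exact: cst_continuous.
have cn : continuous n.
  apply: continuous_maxf; last exact: cst_continuous.
  by apply: continuous_mulf => //; exact: cst_continuous.
have qE u : q u = p u + (-1 * n u + r ^+ 2).
  rewrite /p /n /e; have [] := leP (q u - r ^+ 2) 0;
    have [] := leP (-1 * (q u - r ^+ 2)) 0; lra.
have intE (la : {measure set (borel R d) -> \bar R}) : carried K la ->
    \int[la]_u q u =
    \int[la]_u p u + (- 1 * \int[la]_u n u + r ^+ 2 * fine (la setT)).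
  move=> cla; under eq_Rintegral do rewrite qE.
  have cnN : continuous (fun u => - 1 * n u).
    by apply: continuous_mulf => //; exact: cst_continuous.
  rewrite (RintegralD_carried cla)//; last first.
    by apply: continuous_addf => //; exact: cst_continuous.
  rewrite (RintegralD_carried cla)//; last exact: cst_continuous.
  by rewrite Rintegral_cst_setT (RintegralZ_carried _ cla).
rewrite [leLHS](intE mu cmu) [leRHS](intE nu cnu) munuT.
have pmu : \int[mu]_u p u <= 0.
  have -> : 0 = \int[mu]_u (0 : R) by rewrite Rintegral_cst_setT mul0r.
  apply: (Rintegral_le_on cmu cp (@cst_continuous _ _ 0) (measurable_cball x r)) => //.
  move=> u + _; rewrite /cball /= lee_fin enorm_le// /p /e => ur.
  by rewrite ge_max lexx andbT subr_le0.
have pnu : 0 <= \int[nu]_u p u.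
  by apply: Rintegral_ge0 => u _; rewrite le_max lexx orbT.
have nn : \int[nu]_u n u <= \int[mu]_u n u.
  apply: (Rintegral_sub_on cmu cnu (measurable_oball x r)) => //.
    by move=> u; rewrite le_max lexx orbT.
  move=> u /negP; rewrite /oball /= lte_fin -leNgt -ler_sqr ?nnegrE ?enorm_ge0//.
  by rewrite enorm_sqr => ru; apply/max_idPr; rewrite /e /q; lra.
lra.
Qed.

End Optimality.

(** * Local measures *)

Section LocalMeasureExistence.
Context {R : realType} {d : nat}.
Implicit Types (P M : probability (borel R d) R) (x : 'rV[R]_d) (h r K : R).
Implicit Types Q : {measure set (borel R d) -> \bar R}.

(* M = Q / h for a sub-measure Q of P of mass h. *)
Definition dominated P h M : Prop := forall A : set (borel R d),
  measurable A -> (h%:E * M A <= P A)%E.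

Lemma carried_dominated P h M K : 0 < h -> dominated P h M -> carried K P ->
  carried K M.
Proof.
move=> h0 PM [_ P0]; split.
  by rewrite (le_lt_trans (probability_le1 _ _)) ?ltry.
have mK : measurable (~` cball 0 K%:E : set (borel R d)).
  by apply: measurableC; exact: measurable_cball.
have := PM _ mK; rewrite P0 pmule_rle0 ?lte_fin// measure_le0.
by move/eqP.
Qed.

Lemma normalized_sub_dominated P h (O C : set 'rV[R]_d) M : 0 < h ->
  normalized_sub P h O C M -> dominated P h M.
Proof.
move=> h0 [Q [QP _ _ _ ME]] A mA; rewrite ME// muleA -EFinM divff ?gt_eqF//.
by rewrite mul1e; exact: QP.
Qed.

Lemma local_measures_dominated P h (x : extspace R d) M : 0 < h ->
  local_measures P h x M -> dominated P h M.
Proof. by case: x => [x|v] h0; exact: normalized_sub_dominated. Qed.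

Lemma normalized_sub_exists P h (O C : set 'rV[R]_d) Q : 0 < h -> closed C ->
  submeasure Q P -> Q setT = h%:E ->
  (forall A : set (borel R d), measurable A -> A `<=` O -> Q A = P A) ->
  Q (~` C) = 0%E ->
  exists M, normalized_sub P h O C M /\
    forall A : set (borel R d), M A = (h^-1%:E * Q A)%E.
Proof.
move=> h0 cC QP Qh QO QC.
(* The second argument of [mnormalize] is a fallback for mass 0 or [+oo]; the mass here is h > 0, so
   it is never reached. *)
have ME A : mnormalize Q P A = (h^-1%:E * Q A)%E.
  by rewrite /mnormalize Qh /= eqe gt_eqF//= muleC.
exists (mnormalize Q P); split; last exact: ME.
exists Q; split => //; last by move=> A _; exact: ME.
move=> u suppu; apply: contrapT => nCu.
by have := suppu _ (closed_openC cC) nCu; rewrite QC ltxx.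
Qed.

Lemma delta_ge0 P h x : (0%:E <= delta P h x)%E.
Proof.
by apply: le_ereal_inf_tmp => _ [r [r0 _] <-]; rewrite lee_fin ltW.
Qed.

Lemma le_cball x r s : r <= s -> cball x r%:E `<=` cball x s%:E.
Proof. by move=> rs u; rewrite /cball /= !lee_fin => /le_trans; apply. Qed.

(** Continuity from above: the closed balls of radius r + 1/(n+1) decrease to the ball of radius r,
    and each contains a ball of mass above h by definition of the infimum. *)
Lemma le_measure_cball_delta P h x r : delta P h x = r%:E ->
  (h%:E <= P (cball x r%:E))%E.
Proof.
move=> dr; pose F n : set (borel R d) := cball x (r + n.+1%:R^-1)%:E.
have mF n : measurable (F n) by exact: measurable_cball.
have bF : \bigcap_n F n = cball x r%:E.
  apply/seteqP; split => [u Fu|u ru n _].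
    rewrite /cball /= lee_fin; apply/ler_addgt0Pr => e e0.
    near \oo => n; have := Fu n I; rewrite /F /cball /= lee_fin => /le_trans; apply.
    rewrite lerD2l; apply: ltW; near: n.
    exact: (near_infty_natSinv_lt (PosNum e0)).
  by apply: le_cball ru; rewrite lerDl invr_ge0.
have := @nonincreasing_cvg_mu _ (borel R d) R P F.
rewrite bF => /(_ _ mF (measurable_cball x r)) cF.
have {}cF : (P \o F) n @[n --> \oo] --> P (cball x r%:E).
  apply: cF; first by rewrite (le_lt_trans (probability_le1 _ _)) ?ltry.
  move=> m n mn; rewrite subsetEset; apply: le_cball.
  by rewrite lerD2l lef_pV2 ?posrE// ler_nat.
rewrite -(cvg_lim (@ereal_hausdorff R) cF); apply: lime_ge.
  by apply/cvg_ex; exists (P (cball x r%:E)).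
apply: nearW => n /=.
have : (delta P h x < (r + n.+1%:R^-1)%:E)%E.
  by rewrite dr lte_fin ltrDl invr_gt0.
move=> /ereal_inf_lt[_ [s [s0 hs] <-]]; rewrite lte_fin => /ltW sr.
apply: le_trans (ltW hs) _; apply: le_measure.
- by apply/mem_set; exact: measurable_cball.
- by apply/mem_set; exact: mF.
- exact: le_cball.
Unshelve. all: by end_near. Qed.

(** Continuity from below: the open ball is the increasing union of closed balls of radius r -
    1/(n+1), none of which can have mass above h. *)
Lemma measure_oball_delta_le P h x r : 0 < h -> delta P h x = r%:E ->
  (P (oball x r%:E) <= h%:E)%E.
Proof.
move=> h0 dr; pose F n : set (borel R d) := cball x (r - n.+1%:R^-1)%:E.
have mF n : measurable (F n) by exact: measurable_cball.
have bF : \bigcup_n F n = oball x r%:E.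
  apply/seteqP; split => [u [n _]|u].
    rewrite /F /cball /oball /= lee_fin lte_fin => /le_lt_trans; apply.
    by rewrite ltrBlDr ltrDl invr_gt0.
  rewrite /oball /= lte_fin -subr_gt0 => ur; near \oo => n; exists n => //.
  rewrite /F /cball /= lee_fin lerBrDr -lerBrDl; apply: ltW; near: n.
  exact: (near_infty_natSinv_lt (PosNum ur)).
have := @nondecreasing_cvg_mu _ (borel R d) R P F mF.
rewrite bF => /(_ (measurable_oball x r)) cF.
have {}cF : (P \o F) n @[n --> \oo] --> P (oball x r%:E).
  apply: cF; move=> m n mn; rewrite subsetEset; apply: le_cball.
  by rewrite lerD2l lerN2 lef_pV2 ?posrE// ler_nat.
rewrite -(cvg_lim (@ereal_hausdorff R) cF); apply: lime_le.
  by apply/cvg_ex; exists (P (oball x r%:E)).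
apply: nearW => n /=; rewrite leNgt; apply/negP => hF.
have rn : r - n.+1%:R^-1 < r by rewrite ltrBlDr ltrDl invr_gt0.
(* For r <= 0 the radius of [F n] is negative, so [F n] is empty and cannot have mass above h. *)
have r0 : 0 < r.
  rewrite ltNge; apply/negP => r0; move: hF; rewrite (_ : F n = set0).
    by rewrite measure0 lte_fin; apply/negP; rewrite -leNgt ltW.
  apply/seteqP; split => // u; rewrite /F /cball /= lee_fin => /le_lt_trans.
  move=> /(_ _ rn) /lt_le_trans/(_ r0); rewrite ltNge; apply/negP.
  by rewrite negbK enorm_ge0.
(* Only positive radii compete in [delta], hence the maximum with r / 2: it is positive, its ball
   contains [F n], and yet it is below r. *)
have : (r%:E <= (Num.max (r - n.+1%:R^-1) (r / 2))%:E)%E.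
  rewrite -dr; apply: ereal_inf_lbound; eexists; last reflexivity.
  split; first by rewrite lt_max divr_gt0 ?orbT.
  apply: lt_le_trans hF _; apply: le_measure.
  - by apply/mem_set; exact: mF.
  - by apply/mem_set; exact: measurable_cball.
  - by apply: le_cball; rewrite le_max lexx.
by rewrite lee_fin le_max leNgt rn /=; lra.
Unshelve. all: by end_near. Qed.

(** On the open ball h M' <= P <= h M, hence M' <= M there. Both have mass 1 and M is carried by the
    closed ball, so [concentrated_le] applies. *)
Lemma dominated_power_dist_le P h x r K M : 0 < h -> 0 <= r -> carried K P ->
  dominated P h M ->
  M (~` cball x r%:E) = 0%E ->
  (forall A : set (borel R d), measurable A -> A `<=` oball x r%:E ->
    (P A <= h%:E * M A)%E) ->
  forall M', dominated P h M' -> power_dist M x <= power_dist M' x.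
Proof.
move=> h0 r0 cP PM MC MO M' PM'.
have cM := carried_dominated h0 PM cP; have cM' := carried_dominated h0 PM' cP.
rewrite (power_dist_Rintegral _ cM) (power_dist_Rintegral _ cM').
apply: (concentrated_le cM cM' r0) => // [|A mA AO].
  by have /= -> := probability_setT M; have /= -> := probability_setT M'.
have : (h%:E * M' A <= h%:E * M A)%E := le_trans (PM' A mA) (MO A mA AO).
by rewrite lee_pmul2l// lte_fin.
Qed.

Lemma cball_subset_cball x K : 0 <= K ->
  exists2 r : R, 0 < r & cball 0 K%:E `<=` cball x r%:E.
Proof.
move=> K0; have x0 := dotv_ge0 x.
(* From |u - x|^2 <= 2 |u|^2 + 2 |x|^2 <= r; the summand 1 ensures r <= r^2. *)
pose r := 1 + 2 * K ^+ 2 + 2 * dotv x x.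
have r1 : 1 <= r by rewrite /r; have := sqr_ge0 K; lra.
have r0 : 0 < r by apply: lt_le_trans r1.
exists r => // u; rewrite /cball /= !lee_fin subr0 !enorm_le ?(ltW r0)//.
have ux : 0 <= dotv u u + dotv u x *+ 2 + dotv x x.
  have := dotv_ge0 (u + x).
  by rewrite dotvDl !(dotvC _ (u + x)) !dotvDl (dotvC x u) mulr2n !addrA.
rewrite dotv_sub_sqr => uK; apply: (@le_trans _ _ r).
  by rewrite /r; lra.
by rewrite ler_eXnr.
Qed.

Lemma probability_cball P x r : P (~` cball x r%:E) = 0%E ->
  P (cball x r%:E) = 1%E.
Proof.
move=> P0; have := probability_setC P (measurable_cball x r).
have Pf : P (cball x r%:E) \is a fin_num.
  exact: fin_num_measure (measurable_cball x r).
by rewrite P0 -(fineK Pf) -EFinB => -[] /esym/subr0_eq <-.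
Qed.

(** For finite [delta], the witness takes all of P on the open ball and a fraction t of P on the
    sphere to reach mass h; the mass bounds on the open and closed balls put t in [0, 1]. *)
Lemma local_measure_exists P h x K : 0 < h -> h <= 1 -> 0 <= K ->
  carried K P ->
  exists M, local_measures P h (FinPt x) M /\
    forall M', dominated P h M' -> power_dist M x <= power_dist M' x.
Proof.
move=> h0 h1 K0 cP; rewrite /local_measures.
have muVK (M : probability (borel R d) R) Q :
  (forall A, M A = (h^-1%:E * Q A)%E) -> forall A, (h%:E * M A)%E = Q A.
  by move=> ME A; rewrite ME muleA -EFinM divff ?gt_eqF// mul1e.
case dE : (delta P h x) (delta_ge0 P h x) => [r| |] // d0.
- have r0 : 0 <= r by [].
  have hC := le_measure_cball_delta dE; have hO := measure_oball_delta_le h0 dE.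
  have mO := measurable_oball x r; have mC := measurable_cball x r.
  have OC : oball x r%:E `<=` cball x r%:E.
    by move=> u; rewrite /oball /cball /= => /ltW.
  have mS := measurableD mC mO.
  set S := cball x r%:E `\` oball x r%:E in mS.
  have PO : P (oball x r%:E) \is a fin_num by exact: fin_num_measure mO.
  have PC : P (cball x r%:E) \is a fin_num by exact: fin_num_measure mC.
  have PS : P S = (P (cball x r%:E) - P (oball x r%:E))%E.
    by rewrite measureD ?setIidr// (le_lt_trans (probability_le1 _ _)) ?ltry.
  move: hC hO PS; rewrite -(fineK PO) -(fineK PC) !lee_fin.
  move oE : (fine (P (oball _ _))) => o; move cE : (fine (P (cball _ _))) => c.
  move=> hc oh PS.
  (* If the sphere is null then o = h = c and t = 0 / 0 = 0. *)
  pose t := (h - o) / (c - o).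
  have co : 0 <= c - o by lra.
  have t0 : 0 <= t by rewrite divr_ge0// subr_ge0.
  have t1 : t <= 1.
    have [e|co0] := eqVneq (c - o) 0; first by rewrite /t e invr0 mulr0.
    by rewrite ler_pdivrMr ?lt_def ?co0// mul1r; lra.
  have tE : o + t * (c - o) = h.
    have [e|co0] := eqVneq (c - o) 0; first by rewrite e mulr0; lra.
    by rewrite /t divfK//; lra.
  pose Q : {measure set (borel R d) -> \bar R} :=
    measure_add (mrestr P mO) (mscale (NngNum t0) (mrestr P mS)).
  have QE A : Q A = (P (A `&` oball x r%:E) + t%:E * P (A `&` S))%E.
    exact: measure_addE.
  have QP : submeasure Q P.
    move=> A mA; rewrite QE.
    apply: (@le_trans _ _ (P (A `&` oball x r%:E) + P (A `&` S))%E).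
      by rewrite leeD2l// gee_pMl// ?lee_fin//;
        apply: fin_num_measure; exact: measurableI.
    rewrite -measureU//; [|exact: measurableI|exact: measurableI|].
      rewrite -setIUr; apply: le_measure => //; apply/mem_set => //.
      by apply: measurableI => //; exact: measurableU.
    by apply/seteqP; split => // u [[_ Ou] [_ [_ /(_ Ou)]]].
  have Qh : Q setT = h%:E.
    by rewrite QE !setTI PS -(fineK PO) oE -EFinB -EFinM -EFinD tE.
  have QO (A : set (borel R d)) : measurable A -> A `<=` oball x r%:E -> Q A = P A.
    move=> mA AO; rewrite QE setIidl// (_ : A `&` S = set0).
      by rewrite measure0 mule0 adde0.
    by apply/seteqP; split => // u [/AO Ou [_ /(_ Ou)]].
  have QC : Q (~` cball x r%:E) = 0%E.
    rewrite QE (_ : _ `&` oball _ _ = set0); last first.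
      by apply/seteqP; split => // u [nC /OC].
    rewrite (_ : _ `&` S = set0) ?measure0 ?mule0 ?adde0//.
    by apply/seteqP; split => // u [nC [Cu]].
  have [M [nM ME]] := normalized_sub_exists h0 (@cball_closed _ _ x r) QP Qh QO QC.
  exists M; split => //; apply: (dominated_power_dist_le h0 r0 cP).
  + exact: normalized_sub_dominated nM.
  + by rewrite ME QC mule0.
  + by move=> A mA AO; rewrite (muVK M Q)// QO.
(* For infinite [delta], a ball containing the one that carries P has mass 1, which must not exceed
   h. So h = 1 and P itself is the witness; its optimality is tested on this finite ball. *)
- have [r r0 Kr] := cball_subset_cball x K0.
  have Pr : P (~` cball x r%:E) = 0%E.
    apply/eqP; rewrite -measure_le0; case: cP => _ <-; apply: le_measure.
    + by apply/mem_set/measurableC; exact: measurable_cball.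
    + by apply/mem_set/measurableC; exact: measurable_cball.
    + exact: subsetC.
  have h_1 : h = 1.
    apply/le_anti; rewrite h1 /= -lee_fin leNgt -(probability_cball Pr).
    apply/negP => hP; have : (delta P h x <= r%:E)%E.
      by apply: ereal_inf_lbound; exists r.
    by rewrite dE.
  have [|||||M [nM ME]] := @normalized_sub_exists P h (oball x +oo) (cball x +oo) P h0.
  + rewrite (_ : cball _ _ = setT); first exact: closedT.
    by apply/seteqP; split => // u _; rewrite /cball /= leey.
  + by move=> A _.
  + by rewrite h_1; exact: probability_setT.
  + by [].
  + rewrite (_ : ~` _ = set0) ?measure0//.
    by apply/seteqP; split => // u; rewrite /cball /=; apply; rewrite leey.
  exists M; split => //; apply: (dominated_power_dist_le h0 (ltW r0) cP).
  + exact: normalized_sub_dominated nM.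
  + by rewrite ME [X in (_ * X)%E]Pr mule0.
  + by move=> A mA AO; rewrite (muVK M P).
Qed.

End LocalMeasureExistence.

(** * Voronoi measures *)

Section FiniteMin.
Context {R : realType} {k : nat}.
Implicit Types f g : 'I_k -> R.

(** Starting the fold at [f i0] keeps the minimum real; since i0 is one of the indices, its choice
    does not affect the value. *)
Definition fmin (i0 : 'I_k) f : R := \big[Num.min/f i0]_(i < k) f i.

Lemma fmin_le i0 f i : fmin i0 f <= f i.
Proof. exact: bigmin_le_cond. Qed.

Lemma fmin_attained i0 f : exists i, fmin i0 f = f i.
Proof.
rewrite /fmin; elim/big_ind : _ => [|x y [i ->] [j ->]|i _].
- by exists i0.
- by rewrite minEle; case: ifPn => _; [exists i|exists j].
- by exists i.
Qed.

Lemma bigmin_EFin i0 f :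
  (\big[Order.min/+oo]_(i < k) (f i)%:E = (fmin i0 f)%:E)%E.
Proof.
apply/eqP; rewrite eq_le; apply/andP; split.
  by have [i ->] := fmin_attained i0 f; exact: bigmin_le_cond.
by apply/bigmin_geP; split => [|i _]; rewrite ?leey// lee_fin fmin_le.
Qed.

Lemma fmin_continuous {T : topologicalType} i0 (F : 'I_k -> T -> R) :
  (forall i, continuous (F i)) -> continuous (fun u => fmin i0 (F ^~ u)).
Proof.
move=> cF; rewrite /fmin; elim: (index_enum _) => [|i s IH].
  by under eq_fun do rewrite big_nil; exact: cF.
under eq_fun do rewrite big_cons.
by move=> u; apply: continuous_min; [exact: cF|exact: IH].
Qed.

End FiniteMin.

Section RestrictedMeasures.
Context {R : realType} {d : nat}.
Implicit Types (mu : {measure set (borel R d) -> \bar R}) (K : R).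
Implicit Types f : 'rV[R]_d -> R.

Lemma submeasure_mrestr mu (A : set (borel R d)) (mA : measurable A) :
  submeasure (mrestr mu mA) mu.
Proof.
move=> B mB; rewrite /mrestr /=; apply: le_measure; last exact: subIsetl.
- by apply/mem_set; exact: measurableI.
- exact/mem_set.
Qed.

Lemma Rintegral_mrestr K mu f (A : set (borel R d)) (mA : measurable A) :
  carried K mu -> continuous f ->
  \int[mrestr mu mA]_u f u = \int[mu]_(u in A) f u.
Proof.
move=> cmu cf; have cmuA := carried_sub (@submeasure_mrestr mu A mA) cmu.
rewrite /Rintegral (negligible_integral (measurableC mA))//; last 2 first.
- exact: carried_integrable cmuA cf.
- by rewrite /= /mrestr setICl measure0.
rewrite setTD setCK; congr fine; apply: eq_measure_integral => B mB BA.
by rewrite /= /mrestr setIidl.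
Qed.

(** If f were positive at x, the open set where f > 0 would have positive mass, but it lies in a
    null set as the integral is 0. *)
Lemma msupport_Rintegral_eq0 K mu f x : carried K mu -> continuous f ->
  (forall u, 0 <= f u) -> \int[mu]_u f u = 0 -> msupport mu x -> f x = 0.
Proof.
move=> cmu cf f0 If0 suppx; apply: contrapT => /eqP fx0.
have mf := continuous_measurable_borel cf.
have : (\int[mu]_u `|(f u)%:E| = 0)%E.
  under eq_integral do rewrite gee0_abs ?lee_fin//.
  rewrite -[LHS]fineK; first by rewrite -/(Rintegral mu setT f) If0.
  exact/integrable_fin_num/(carried_integrable cmu cf).
move/ae_eq_integral_abs => -[//||N [mN N0 fN]].
  exact/measurable_EFinP.
pose U := f @^-1` [set y | 0 < y].
have oU : open U by apply: open_comp; [move=> u _; exact: cf|exact: open_gt].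
have := suppx U oU; rewrite /U /= lt_def fx0 f0 => /(_ isT).
rewrite ltNge => /negP; apply; rewrite -N0; apply: le_measure.
- by apply/mem_set; exact: open_measurable_borel.
- exact/mem_set.
move=> u Uu; apply: fN => /= /(_ I) [] fu; move: Uu; rewrite /U /= fu.
by rewrite ltxx.
Qed.

Lemma voronoi_exists k (i0 : 'I_k) K (P : probability (borel R d) R)
  (F : 'I_k -> 'rV[R]_d -> R) : carried K P -> (forall i, continuous (F i)) ->
  exists V : 'I_k -> {measure set (borel R d) -> \bar R},
    [/\ forall i, submeasure (V i) P,
        forall A : set (borel R d), measurable A -> (\sum_(i < k) V i A)%E = P A,
        forall f, continuous f ->
          \int[P]_u f u = \sum_(i < k) \int[V i]_u f u &
        forall i, \int[V i]_u F i u = \int[V i]_u fmin i0 (F ^~ u)].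
Proof.
move=> cP cF.
pose C i : set (borel R d) := [set u | F i u = fmin i0 (F ^~ u)].
have mC i : measurable (C i).
  have cD : continuous (fun u => F i u - fmin i0 (F ^~ u)).
    by apply: continuous_subf => //; exact: fmin_continuous.
  rewrite (_ : C i = (fun u => F i u - fmin i0 (F ^~ u)) @^-1` [set 0]).
    apply: closed_measurable_borel; apply: preimage_closed.
      by move=> u _; exact: cD.
    exact: closed_eq.
  apply/seteqP; split => u; rewrite /C /=; first by move=> ->; rewrite subrr.
  by move/subr0_eq.
(* Ties go to the smallest index, which turns the overlapping cells [C i] into a partition. *)
pose A i : set (borel R d) := C i `\` \bigcup_(j in [set j : 'I_k | (j < i)%N]) C j.
have mA i : measurable (A i).
  by apply: measurableD => //; apply: fin_bigcup_measurable.
have tA : trivIset setT A.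
  move=> i j _ _ [u [[Ci nCi] [Cj nCj]]]; apply/val_inj.
  have [ij|ji|//] := ltngtP i j.
    by case: nCj; exists i.
  by case: nCi; exists j.
have UA : \big[setU/set0]_(i < k) A i = setT.
  rewrite -bigcup_seq; apply/seteqP; split => // u _.
  have [i1 Ci1] := fmin_attained i0 (F ^~ u).
  have Ci1' : `[< C i1 u >] by apply/asboolP; rewrite /C /= Ci1.
  case: (@arg_minnP _ i1 (fun i => `[< C i u >]) (fun i => i : nat) Ci1').
  move=> i /asboolP Ci imin.
  exists i; first by rewrite /= mem_index_enum.
  split => // -[j /= ji Cj]; have := imin j; rewrite leqNgt ji => /(_ _)/negP.
  by apply => //; exact/asboolP.
exists (fun i => mrestr P (mA i)); split => [i|B mB|f cf|i].
- exact: submeasure_mrestr.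
- rewrite /= /mrestr -measure_bigsetU_ord.
  + by rewrite -bigcup_seq -setI_bigcupr bigcup_seq UA setIT.
  + by move=> i; exact: measurableI.
  + exact: trivIset_setIl.
- under eq_bigr => i _ do rewrite (Rintegral_mrestr (mA i) cP cf).
  rewrite /Rintegral -UA integral_bigsetU_EFin//; last 3 first.
  + exact: index_enum_uniq.
  + exact: sub_trivIset tA.
  + by apply/measurable_EFinP/measurable_funTS; exact: continuous_measurable_borel.
  rewrite sum_fine// => i _; apply: integrable_fin_num => //.
  by apply: integrableS (carried_integrable cP cf).
- rewrite (Rintegral_mrestr (mA i) cP (cF i)).
  rewrite (Rintegral_mrestr (mA i) cP (fmin_continuous cF)).
  by apply: eq_Rintegral => u /set_mem[].
Qed.

End RestrictedMeasures.

(** * Minimization over the moments *)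

(* Products are not declared pointed topological types in the library, and
   [rV_compact] needs them to be. *)
HB.saturate prod.

Section Minimization.
Context {R : realType} {d k : nat}.
Implicit Types (K h : R) (P M : probability (borel R d) R).
Let T := ('rV[R]_d * R)%type.
Implicit Types (p q : T) (th : 'rV[T]_k) (u : 'rV[R]_d).

Lemma entry_continuous (U : topologicalType) (i : 'I_k) :
  continuous (fun th : 'rV[U]_k => th 0 i).
Proof.
move=> th A nA; exists (fun _ j => if j == i then A else setT).
  by move=> i0 j; case: eqP => [->|_]; [rewrite (ord1 i0)|exact: filterT].
by move=> th' /(_ 0 i); rewrite eqxx.
Qed.

Definition moments M : T := (vmean M, second_moment M).

(** Uniformity in u over the ball is what allows the estimate to pass through the minimum and the
    integral in [rho]. *)
Lemma paraboloid_near K p (e : R) : 0 <= K -> 0 < e ->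
  \forall q \near p, forall u, cball 0 K%:E u ->
    `|paraboloid q.1 q.2 u - paraboloid p.1 p.2 u| <= e.
Proof.
move=> K0 e0.
(* The difference of the two paraboloids is affine in u, and each coordinate of u is at most K in
   absolute value. *)
pose gap (q : T) : R :=
  \sum_(j < d) 2 * K * `|q.1 0 j - p.1 0 j| + `|q.2 - p.2|.
have cgap : continuous gap.
  apply: continuous_addf.
    apply: continuous_big => [|j _]; first exact: add_continuous.
    apply: continuous_mulf; first exact: cst_continuous.
    move=> q; apply: (@continuous_comp _ _ _ (fun q : T => q.1 0 j - p.1 0 j)).
      apply: continuous_subf; last exact: cst_continuous.
      move=> {}q.
      apply: (@continuous_comp _ _ _ fst (fun m : 'rV[R]_d => m 0 j)).
        exact: cvg_fst.
      exact: coord_continuous.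
    exact: norm_continuous.
  move=> q; apply: (@continuous_comp _ _ _ (fun q : T => q.2 - p.2)).
    apply: continuous_subf; last exact: cst_continuous.
    by move=> {}q; exact: cvg_snd.
  exact: norm_continuous.
have gap0 : gap p = 0.
  rewrite /gap subrr normr0 addr0 big1// => j _.
  by rewrite subrr normr0 mulr0.
have gape : \forall q \near p, gap q < e.
  by apply: (cvgr_lt (gap p) (cgap p)); rewrite gap0.
near=> q => u; rewrite /cball /= lee_fin subr0 => uK.
have -> : paraboloid q.1 q.2 u - paraboloid p.1 p.2 u =
    - 2 * dotv (q.1 - p.1) u + (q.2 - p.2).
  by rewrite dotvDl dotvNl /paraboloid !(dotvC _ u); ring.
apply: (@le_trans _ _ (gap q)); last by apply: ltW; near: q.
apply: le_trans (ler_normD _ _) _; rewrite lerD2r /dotv mulr_sumr.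
apply: le_trans (ler_norm_sum _ _ _) _; apply: ler_sum => j _.
rewrite !normrM normrN (ger0_norm (ler0n _ 2)) !mxE -mulrA ler_pM2l// mulrC.
by rewrite ler_wpM2r// (le_trans (normr_coord_le_enorm _ _)).
Unshelve. all: by end_near. Qed.

(** [risk] in terms of the moment parameters, defined also at limit pairs not known to be moments of
    a measure. *)
Definition rho P (i0 : 'I_k) th : R :=
  \int[P]_u fmin i0 (fun i => paraboloid (th 0 i).1 (th 0 i).2 u).

Lemma rho_le K P i0 th th' (e : R) : carried K P ->
  (forall i u, cball 0 K%:E u ->
    paraboloid (th 0 i).1 (th 0 i).2 u <=
    paraboloid (th' 0 i).1 (th' 0 i).2 u + e) ->
  rho P i0 th <= rho P i0 th' + e.
Proof.
move=> cP le_e; have cF (t : 'rV[T]_k) :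
    continuous (fun u => fmin i0 (fun i => paraboloid (t 0 i).1 (t 0 i).2 u)).
  by apply: fmin_continuous => i; exact: paraboloid_continuous.
have -> : rho P i0 th' + e = \int[P]_u
    (fmin i0 (fun i => paraboloid (th' 0 i).1 (th' 0 i).2 u) + e).
  rewrite (RintegralD_carried cP)//; last exact: cst_continuous.
  rewrite Rintegral_cst_setT; have /= -> := probability_setT P.
  by rewrite mulr1.
apply: (Rintegral_le_on cP _ _ (measurable_cball 0 K)) => //.
- by apply: continuous_addf => //; exact: cst_continuous.
- by case: cP.
move=> u uK _; have [i ->] := fmin_attained i0
  (fun i => paraboloid (th' 0 i).1 (th' 0 i).2 u).
by apply: le_trans (le_e i u uK); exact: fmin_le.
Qed.

(** Near [th] each of the finitely many paraboloids is uniformly e-close on the ball; [rho_le] in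
    both directions bounds the change of [rho] by e. *)
Lemma rho_continuous K P i0 : 0 <= K -> carried K P -> continuous (rho P i0).
Proof.
move=> K0 cP th; apply/(@cvgrPdist_le _ _ _ _ (nbhs_filter th)) => e e0.
have near_th : nbhs th [set th' : 'rV[T]_k | forall i u, cball 0 K%:E u ->
    `|paraboloid (th' 0 i).1 (th' 0 i).2 u -
      paraboloid (th 0 i).1 (th 0 i).2 u| <= e].
  apply: (@filter_forall _ _ (fun i th' => forall u, cball 0 K%:E u ->
    `|paraboloid (th' 0 i).1 (th' 0 i).2 u -
      paraboloid (th 0 i).1 (th 0 i).2 u| <= e) _ (nbhs_filter th)) => i.
  exact: (entry_continuous (paraboloid_near (th 0 i) K0 e0)).
apply: (@filterS _ _ (nbhs_filter th) _ _ _ near_th) => th' H.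
rewrite ler_distl; apply/andP; split.
  rewrite lerBlDr; apply: (rho_le i0 cP) => i u /(H i).
  by rewrite ler_distl => /andP[_].
apply: (rho_le i0 cP) => i u /(H i).
by rewrite ler_distl lerBlDr => /andP[].
Qed.

Definition attainable P h : set T := [set moments M | M in dominated P h].

Lemma closure_attainable_compact K P h : 0 <= K -> 0 < h -> carried K P ->
  compact (closure (attainable P h)).
Proof.
move=> K0 h0 cP.
have cB : compact (cball 0 K%:E `*` `[0, K ^+ 2]%classic : set T).
  by apply: compact_setX; [exact: cball_compact|exact: segment_compact].
apply: (subclosed_compact (@closed_closure _ _) cB).
have clB : closed (cball 0 K%:E `*` `[0, K ^+ 2]%classic : set T).
  by apply: compact_closed cB; exact: norm_hausdorff.
rewrite [X in _ `<=` X](closure_id _).1//; apply: closureS => _ [M PM <-].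
have cM := carried_dominated h0 PM cP; have /= M1 := probability_setT M.
split => /=.
  (* M has mass 1, so its [vmean] is its [wmean], which lies in the ball. *)
  have := wmean_cball K0 cM; rewrite -[X in cball _ _ X]scale1r.
  by rewrite -[1]/(fine 1%E) -M1 -(vmean_wmean cM).
rewrite in_itv /= second_moment_ge0 /=.
by have /= := second_moment_le K0 cM; rewrite [X in fine X]M1 mulr1.
Qed.

(** At fixed c the value is continuous in the parameters, so the bound defines a closed set. This
    extends the optimality of a local measure to limit parameters. *)
Lemma closure_attainable_ge P h p c (a : R) :
  (forall M, dominated P h M -> a <= paraboloid (vmean M) (second_moment M) c) ->
  closure (attainable P h) p -> a <= paraboloid p.1 p.2 c.
Proof.
move=> aM; pose C : set T := [set q | a <= paraboloid q.1 q.2 c].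
have clC : closed C.
  apply: (@preimage_closed _ _ (fun q : T => paraboloid q.1 q.2 c) [set y | a <= y]).
    move=> q _; move: q; apply: continuous_addf; first exact: cst_continuous.
    apply: continuous_addf; last by move=> q; exact: cvg_snd.
    apply: continuous_mulf; first exact: cst_continuous.
    move=> q; apply: (@continuous_comp _ _ _ fst (dotv c)); first exact: cvg_fst.
    exact: dotv_continuous.
  exact: closed_ge.
have SC : closure (attainable P h) `<=` C.
  rewrite [X in _ `<=` X](closure_id C).1//; apply: closureS => _ [M PM <-].
  exact: aM.
exact: SC.
Qed.

Lemma rho_minimizer K P h i0 : 0 <= K -> 0 < h -> h <= 1 -> carried K P ->
  exists2 th : 'rV[T]_k, forall i, closure (attainable P h) (th 0 i) &
    forall M : 'I_k -> probability (borel R d) R,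
      (forall i, dominated P h (M i)) ->
      rho P i0 th <= \int[P]_u fmin i0 (fun i => power_dist (M i) u).
Proof.
move=> K0 h0 h1 cP.
pose A := [set th : 'rV[T]_k | forall i, closure (attainable P h) (th 0 i)].
have cA : compact A.
  exact: (@rV_compact _ k (fun=> closure (attainable P h))
    (fun=> closure_attainable_compact K0 h0 cP)).
have inA (M : 'I_k -> probability (borel R d) R) :
    (forall i, dominated P h (M i)) -> A (\row_i moments (M i)).
  by move=> PM i; rewrite mxE; apply: subset_closure; exists (M i).
(* P itself is dominated because h <= 1. *)
have A0 : A !=set0.
  exists (\row_i moments P); apply: (inA (fun=> P)) => _ B mB.
  by rewrite gee_pMl// ?lee_fin//; exact: fin_num_measure.
have [|th /set_mem thA thmin] := compact_EVT_min (f := rho P i0) A0 cA.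
  by apply: continuous_subspaceT; exact: rho_continuous K0 cP.
exists th => // M PM; apply: le_trans (thmin _ (mem_set (inA M PM))) _.
rewrite le_eqVlt; apply/orP; left; apply/eqP; apply: eq_Rintegral => u _.
congr (fmin _ _); apply/funext => i.
by rewrite mxE (power_distE (carried_dominated h0 (PM i) cP)).
Qed.

End Minimization.

(** * Finiteness of the risk and optimality of the centroids *)

Lemma riskE {R : realType} {d k : nat} (i0 : 'I_k)
    (P : probability (borel R d) R) (M : 'I_k -> probability (borel R d) R) (h K : R) : 0 < h ->
  carried K P -> (forall i, dominated P h (M i)) ->
  risk P M = (\int[P]_u fmin i0 (fun i => power_dist (M i) u))%:E.
Proof.
move=> h0 cP PM; rewrite /risk; under eq_integral do rewrite (bigmin_EFin i0).
rewrite /Rintegral fineK//; apply: integrable_fin_num => //.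
apply: (carried_integrable cP); apply: fmin_continuous => i.
by rewrite (power_distE (carried_dominated h0 (PM i) cP)); exact: paraboloid_continuous.
Qed.

Theorem theorem13 (R : realType) (d : nat) (d_gt0 : (0 < d)%N)
  (h : R) (h_gt0 : 0 < h) (h_le1 : h <= 1)
  (k : nat) (k_gt0 : (0 < k)%N) (K : R) (K_gt0 : 0 < K)
  (P : probability (borel R d) R)
  (supp_P : msupport P `<=` cball 0 K%:E)
  (bdry_P : forall v : 'rV[R]_d, enorm v = 1 ->
     P (boundary (halfspace v (clevel P h v))) = 0%E) :
  Opt k P h !=set0 /\
  exists (s : 'I_k -> 'rV[R]_d)
         (M : 'I_k -> probability (borel R d) R)
         (V : 'I_k -> {measure set (borel R d) -> \bar R}),
    [/\ Opt k P h (fun i => FinPt (s i)),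
        forall i, cball 0 K%:E (s i),
        minimizes P h (fun i => FinPt (s i)) M,
        weighted_voronoi P M V &
        forall i, s i = wmean (V i)].
Proof.
have K0 := ltW K_gt0; have cP := carried_msupport supp_P.
pose i0 := Ordinal k_gt0.
have [th thS thmin] := rho_minimizer i0 K0 h_gt0 h_le1 cP.
pose F i := paraboloid (th 0 i).1 (th 0 i).2.
have cF i : continuous (F i) by exact: paraboloid_continuous.
have [V [VP VS VI VF]] := voronoi_exists i0 cP cF.
have cV i : carried K (V i) := carried_sub (VP i) cP.
(* A null [V i] gives the point 0, where a local measure exists as everywhere else. *)
pose c i := wmean (V i).
have [M MP] := choice (fun i => local_measure_exists (c i) h_gt0 h_le1 K0 cP).
have PM i : dominated P h (M i) by exact: local_measures_dominated (MP i).1.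
pose G i := power_dist (M i).
have GE i : G i = paraboloid (vmean (M i)) (second_moment (M i)).
  exact: power_distE (carried_dominated h_gt0 (PM i) cP).
have cG i : continuous (G i) by rewrite GE; exact: paraboloid_continuous.
have cmG := fmin_continuous (i0 := i0) cG.
(* Only the values at [c i] matter, and there [M i] does at least as well as every dominated
   measure, hence as the limit pair [th 0 i]. *)
have GF i : \int[V i]_u G i u <= \int[V i]_u F i u.
  rewrite GE !(Rintegral_paraboloid_wmean _ _ (cV i)) lerD2l.
  rewrite ler_wpM2l ?fine_ge0// lerD2r -GE.
  apply: closure_attainable_ge (thS i) => M' PM'.
  rewrite -(power_distE (carried_dominated h_gt0 PM' cP)).
  exact: (MP i).2.
have sumG : \sum_(i < k) \int[V i]_u G i u <= rho P i0 th.
  rewrite /rho (VI _ (fmin_continuous cF)).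
  by apply: ler_sum => i _; rewrite -VF.
have minG : rho P i0 th <= \int[P]_u fmin i0 (G ^~ u) := thmin M PM.
(* The sum of the integrals of [G i] over [V i] is at most [rho P i0 th], which is at most the
   integral of the minimum of the [G i] over P. These nonnegative gaps therefore sum to 0, and each
   vanishes. *)
have mGG i : 0 <= \int[V i]_u (G i u - fmin i0 (G ^~ u)).
  by apply: Rintegral_ge0 => u _; rewrite subr_ge0; exact: fmin_le.
have mGB i : \int[V i]_u (G i u - fmin i0 (G ^~ u)) =
    \int[V i]_u G i u - \int[V i]_u fmin i0 (G ^~ u).
  by apply: RintegralB => //; apply: (carried_integrable (cV i)).
have sum0 : \sum_(i < k) \int[V i]_u (G i u - fmin i0 (G ^~ u)) = 0.
  apply/le_anti; rewrite sumr_ge0// andbT.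
  under eq_bigr do rewrite mGB.
  by rewrite sumrB -VI// subr_le0; exact: le_trans minG.
have gap0 i : \int[V i]_u (G i u - fmin i0 (G ^~ u)) = 0.
  by apply: (psumr_eq0P _ sum0).
(* A competitor may use points at infinity: its local measures are dominated all the same, and
   [thmin] covers every dominated family. *)
have minM : minimizes P h (fun i => FinPt (c i)) M.
  split => [i|t' M' PM']; first exact: (MP i).1.
  have dM' i : dominated P h (M' i) by exact: local_measures_dominated (PM' i).
  rewrite (riskE i0 h_gt0 cP PM) (riskE i0 h_gt0 cP dM') lee_fin.
  apply: le_trans (thmin M' dM'); apply: le_trans sumG.
  rewrite VI//; apply: ler_sum => i _; apply: (Rintegral_le (cV i)) => // u.
  exact: fmin_le.
have OptM : Opt k P h (fun i => FinPt (c i)) by exists M.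
split; first by exists (fun i => FinPt (c i)).
exists c, M, V; split => //.
- by move=> i; exact: wmean_cball (cV i).
- split => // i x suppx j.
  (* The gap is continuous, nonnegative and of zero integral, so it vanishes on the whole support of
     [V i]; this is the Voronoi inequality for the [M i] instead of [th]. *)
  have cD : continuous (fun u => G i u - fmin i0 (G ^~ u)).
    exact: continuous_subf.
  have : G i x - fmin i0 (G ^~ x) = 0.
    apply: (msupport_Rintegral_eq0 (cV i) cD _ (gap0 i) suppx) => u.
    by rewrite subr_ge0; exact: fmin_le.
  by rewrite -/(G i x) => /subr0_eq ->; exact: fmin_le.
Qed.
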